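(* Let $d\ge 1$ be an integer and $\lambda=(d-1)/2$. (a) The family $\{\mathrm{Wat}_d(\eta,\rho):\eta\in\mathbb{S}_d,\ \rho\ge 0\}$ of Watson distributions has a unique discrete mixture representation with mixing base $\mathrm{SP}_d(\eta,n)$, $n\in\mathbb{N}_0$. This representation is given by $$\mathrm{Wat}_d(\eta,\rho)=\sum_{n=0}^\infty \mathrm{chs}(n\,|\,\tfrac12,\lambda+1,\rho)\,\mathrm{SP}_d(\eta,n).$$ (b) The family $\{\mathrm{Wat}_d(\eta,\rho):\eta\in\mathbb{S}_d,\ \rho\le 0\}$ has a unique discrete mixture representation with mixing base $\mathrm{SBeta}_d(\eta,n+1,n+1)$, $n\in\mathbb{N}_0$. This representation is given by $$\mathrm{Wat}_d(\eta,\rho)=\sum_{n=0}^\infty \mathrm{chs}(n\,|\,\lambda+\tfrac12,\lambda+1,-\rho)\,\mathrm{SBeta}_d(\eta,n+1,n+1).$$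
   Context: $\mathbb{S}_d=\{x\in\mathbb{R}^{d+1}:\|x\|=1\}$ with Borel $\sigma$-field and uniform distribution $\mathrm{unif}(\mathbb{S}_d)$; all densities on $\mathbb{S}_d$ are with respect to $\mathrm{unif}(\mathbb{S}_d)$, and $\eta^{t}x$ is the Euclidean inner product. Write $(\alpha)_n=\Gamma(\alpha+n)/\Gamma(\alpha)$ for $\alpha>0$, $n\in\mathbb{N}_0=\{0,1,2,\dots\}$, and ${}_1F_1(\alpha;\beta;x)=\sum_{n\ge0}\frac{(\alpha)_n}{(\beta)_n n!}x^n$, $x\in\mathbb{R}$. Discrete mixture representation: given a family $\{P_{\eta,\rho}:\eta\in\mathbb{S}_d,\rho\in I\}$ of probability measures on $\mathbb{S}_d$ and, for each $\eta$, a sequence $(Q_{n,\eta})_{n\in\mathbb{N}_0}$ of probability measures on $\mathbb{S}_d$ (the mixing base), a discrete mixture representation of the family with this mixing base is a family $(w_\rho)_{\rho\in I}$ of probability mass functions on $\mathbb{N}_0$ (depending on $\rho$ only) with $P_{\eta,\rho}=\sum_{n=0}^\infty w_\rho(n)Q_{n,\eta}$ (pointwise on Borel sets) for all $\eta\in\mathbb{S}_d$, $\rho\in I$. It is unique if there is exactly one such family $(w_\rho)_{\rho\in I}$. Distributions ($\eta\in\mathbb{S}_d$): - $\mathrm{Wat}_d(\eta,\rho)$, $\rho\in\mathbb{R}$: density $x\mapsto \bigl({}_1F_1(\tfrac12;\lambda+1;\rho)\bigr)^{-1}\exp\bigl(\rho(\eta^{t}x)^2\bigr)$. - $\mathrm{SP}_d(\eta,n)$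 (spherical power distribution), $n\in\mathbb{N}_0$: density $x\mapsto\frac{(\lambda+1)_n}{(1/2)_n}(\eta^{t}x)^{2n}$. - $\mathrm{SBeta}_d(\eta,p,q)$, $p,q>\frac12-\lambda$: density $x\mapsto c_d(p,q)(1-\eta^{t}x)^{p-1}(1+\eta^{t}x)^{q-1}$ with $c_d(p,q)=2^{-(p+q+2(\lambda-1))}\frac{\Gamma(1/2)\Gamma(\lambda+1/2)\Gamma(p+q+2\lambda-1)}{\Gamma(\lambda+1)\Gamma(p+\lambda-1/2)\Gamma(q+\lambda-1/2)}$. - $\mathrm{chs}(n|\alpha,\beta,\tau)=\bigl({}_1F_1(\alpha;\beta;\tau)\bigr)^{-1}\frac{(\alpha)_n}{(\beta)_n}\frac{\tau^n}{n!}$, $n\in\mathbb{N}_0$, for $\alpha,\beta,\tau>0$; for $\tau=0$ it is the one-point mass at $0$. *)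

(* Defs.v *)
From HB Require Import structures.
From mathcomp Require Import all_boot all_order all_algebra.
From mathcomp Require Import all_classical all_reals all_analysis.
Set Implicit Arguments.
Unset Strict Implicit.
Unset Printing Implicit Defensive.
Import Order.TTheory GRing.Theory Num.Theory.
Import numFieldNormedType.Exports.
Local Open Scope classical_set_scope.
Local Open Scope ring_scope.

(* Row vectors carry the sup norm in the library, hence a separate Euclidean
   norm; both induce the same topology. *)
Definition dot (R : realType) (m : nat) (x y : 'rV[R]_m) : R :=
  \sum_(i < m) x 0 i * y 0 i.

Definition enorm (R : realType) (m : nat) (x : 'rV[R]_m) : R :=
  Num.sqrt (dot x x).

Definition unit_sphere (R : realType) (d : nat) : set 'rV[R]_d.+1 :=
  [set x | enorm x = 1].

(* The sphere as a type; through set_type it gets the subspace topology. *)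
Definition sphere (R : realType) (d : nat) : Type := set_type (@unit_sphere R d).

HB.instance Definition _ (R : realType) (d : nat) :=
  SubType.copy (sphere R d) (set_type (@unit_sphere R d)).
HB.instance Definition _ (R : realType) (d : nat) :=
  Topological.copy (sphere R d) (set_type (@unit_sphere R d)).

Lemma unit_sphere_e0 (R : realType) (d : nat) :
  @unit_sphere R d (delta_mx 0 ord0).
Proof.
rewrite /unit_sphere /= /enorm /dot (bigD1 ord0)//= big1 => [|i ne0].
  by rewrite !mxE !eqxx mulr1 addr0 sqrtr1.
by rewrite !mxE eqxx/= (negbTE ne0) mulr0.
Qed.

HB.instance Definition _ (R : realType) (d : nat) :=
  isPointed.Build (sphere R d)
    (Sub (delta_mx 0 ord0) (mem_set (@unit_sphere_e0 R d))).

Notation bsphere R d := (g_sigma_algebraType (@open (sphere R d))).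

Lemma unit_sphere_mulmx (R : realType) (d : nat) (O : 'M[R]_d.+1)
    (hO : O *m O^T = 1%:M) (x : sphere R d) :
  unit_sphere (val x *m O).
Proof.
have dotE (u v : 'rV[R]_d.+1) : dot u v = (u *m v^T) 0 0.
  by rewrite mxE; apply: eq_bigr => i _; rewrite mxE.
case: x => x /= /set_mem; rewrite /unit_sphere /= /enorm => <-.
by rewrite !dotE trmx_mul mulmxA -(mulmxA x) hO mulmx1.
Qed.

Definition sphere_isometry (R : realType) (d : nat) (O : 'M[R]_d.+1)
    (hO : O *m O^T = 1%:M) (x : sphere R d) : sphere R d :=
  Sub (val x *m O) (mem_set (unit_sphere_mulmx hO x)).

(* The uniform distribution on the sphere: the (unique) Borel probability
   measure that is invariant under the orthogonal group. *)
Definition is_uniform (R : realType) (d : nat)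
    (mu : probability (bsphere R d) R) : Prop :=
  forall (O : 'M[R]_d.+1) (hO : O *m O^T = 1%:M) (A : set (bsphere R d)),
    measurable A -> mu (sphere_isometry hO @^-1` A) = mu A.

Definition lambda (R : realType) (d : nat) : R := (d%:R - 1) / 2.

Definition Gamma (R : realType) (a : R) : R :=
  \int[@lebesgue_measure R]_(t in `]0, +oo[%classic) (t `^ (a - 1) * expR (- t)).

Definition pochhammer (R : realType) (a : R) (n : nat) : R :=
  Gamma (a + n%:R) / Gamma a.

Definition hyp1F1 (R : realType) (a b x : R) : R :=
  limn (series (fun n : nat =>
    pochhammer a n / (pochhammer b n * n`!%:R) * x ^+ n)).

Definition chs (R : realType) (n : nat) (a b tau : R) : R :=
  if tau == 0 then (n == 0)%:R
  else (hyp1F1 a b tau)^-1 * (pochhammer a n / pochhammer b n)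
       * (tau ^+ n / n`!%:R).

Definition with_density (R : realType) (d : nat)
    (unif : probability (bsphere R d) R) (f : sphere R d -> R)
    (A : set (bsphere R d)) : \bar R :=
  (\int[unif]_(x in A) (f x)%:E)%E.

Definition Wat (R : realType) (d : nat) (unif : probability (bsphere R d) R)
    (eta : sphere R d) (rho : R) : set (bsphere R d) -> \bar R :=
  with_density unif (fun x =>
    (hyp1F1 (1 / 2) (lambda R d + 1) rho)^-1
    * expR (rho * dot (val eta) (val x) ^+ 2)).

Definition SP (R : realType) (d : nat) (unif : probability (bsphere R d) R)
    (eta : sphere R d) (n : nat) : set (bsphere R d) -> \bar R :=
  with_density unif (fun x =>
    pochhammer (lambda R d + 1) n / pochhammer (1 / 2) n
    * dot (val eta) (val x) ^+ (2 * n)).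

Definition SBeta_const (R : realType) (d : nat) (p q : R) : R :=
  let lam := lambda R d in
  2 `^ (- (p + q + 2 * (lam - 1)))
  * (Gamma (1 / 2) * Gamma (lam + 1 / 2) * Gamma (p + q + 2 * lam - 1)
     / (Gamma (lam + 1) * Gamma (p + lam - 1 / 2) * Gamma (q + lam - 1 / 2))).

Definition SBeta (R : realType) (d : nat) (unif : probability (bsphere R d) R)
    (eta : sphere R d) (p q : R) : set (bsphere R d) -> \bar R :=
  with_density unif (fun x =>
    SBeta_const d p q * (1 - dot (val eta) (val x)) `^ (p - 1)
    * (1 + dot (val eta) (val x)) `^ (q - 1)).

(* The distributions above are plain set functions; this says that one of them
   is a probability measure on the Borel sets. *)
Definition is_probability (R : realType) (d : nat)
    (mu : set (bsphere R d) -> \bar R) : Prop :=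
  exists P : probability (bsphere R d) R,
    forall A, measurable A -> mu A = P A.

Definition is_pmf (R : realType) (w : nat -> R) : Prop :=
  (forall n, 0 <= w n) /\ (\sum_(0 <= n <oo) (w n)%:E = 1)%E.

Definition discrete_mixture_rep (R : realType) (d : nat) (I : Type)
    (P : sphere R d -> I -> set (bsphere R d) -> \bar R)
    (Q : nat -> sphere R d -> set (bsphere R d) -> \bar R)
    (w : I -> nat -> R) : Prop :=
  [/\ forall eta rho, is_probability (P eta rho),
      forall n eta, is_probability (Q n eta),
      forall rho, is_pmf (w rho) &
      forall eta rho (A : set (bsphere R d)), measurable A ->
        (P eta rho A = \sum_(0 <= n <oo) (w rho n)%:E * Q n eta A)%E].

Definition has_unique_discrete_mixture_rep (R : realType) (d : nat) (I : Type)
    (P : sphere R d -> I -> set (bsphere R d) -> \bar R)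
    (Q : nat -> sphere R d -> set (bsphere R d) -> \bar R) : Prop :=
  exists! w : I -> nat -> R, discrete_mixture_rep P Q w.

(* Main.v *)
From HB Require Import structures.
Require Import Defs.
From mathcomp Require Import all_boot all_order all_algebra.
From mathcomp Require Import all_classical all_reals all_analysis.
From mathcomp Require Import measurable_realfun.
From mathcomp Require Import ring lra.
Import Order.TTheory GRing.Theory Num.Theory.
Import numFieldNormedType.Exports.
Local Open Scope classical_set_scope.
Local Open Scope ring_scope.

Set Implicit Arguments.
Unset Strict Implicit.

(** Let [U = (eta . x)^2]. Rotation invariance gives
    [E[(x_i + t x_j)^(2n)] = (1 + t^2)^n E[x_0^(2n)]]; the coefficient of [t^2]
    and [\sum_j x_j^2 = 1] yield a recursion for the moments of [U], hence
    [E[U^n (1-U)^k] = (1/2)_n (lambda+1/2)_k / (lambda+1)_(n+k)].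
    Both parts are then one statement about a variable [U] in [0,1] with
    [E[U^n (1-U)^k] = (a)_n (a')_k / (a+a')_(n+k)]: expanding [exp(tau U)] for
    [tau >= 0] gives the mixture of the densities proportional to [U^n]. Part (b)
    is the case of [1 - U], since [exp(rho U) = exp(rho) exp(-rho (1-U))].
    For uniqueness, integrating [(1-U)^k] against a mixture with weights [w]
    determines [\sum_n w_n (b)_n / (b)_(n+k)], [b = a+a'], for every [k]; dividing
    by the [N]-th ratio and letting [k] tend to infinity recovers [w_N] from
    [w_0, ..., w_(N-1)]. *)

(** * The Gamma function and Pochhammer symbols *)

Section GammaFunction.
Context {R : realType}.
Implicit Types a t : R.
Local Notation mu := (@lebesgue_measure R).

Definition gamma_fun a t : R := t `^ (a - 1) * expR (- t).

(** Extended-valued, so that the functional equation can be established before finiteness is known;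
    [Gamma] is its [fine] part. *)
Definition eGamma a : \bar R :=
  (\int[mu]_(t in `]0%R, +oo[) (gamma_fun a t)%:E)%E.

Lemma gamma_fun_ge0 a t : 0 <= gamma_fun a t.
Proof. by rewrite mulr_ge0 ?powR_ge0 ?expR_ge0. Qed.

Lemma measurable_gamma_fun a : measurable_fun setT (gamma_fun a).
Proof.
apply: measurable_funM; first exact: measurable_powR.
by apply: measurableT_comp => //; exact: measurableT_comp.
Qed.

Lemma powR_expRN_cvg0 a :
  (n.+2%:R `^ a * expR (- n.+2%:R) : R) @[n --> \oo] --> (0 : R).
Proof.
set k := (Num.truncn a).+1.
have ak : a <= k%:R by rewrite /k ltW// truncnS_gt.
apply: (@squeeze_cvgr _ _ _ _ (fun=> 0) (fun n => k.+1`!%:R / n.+2%:R)).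
- near=> n; rewrite mulr_ge0 ?powR_ge0 ?expR_ge0//=.
  rewrite expRN ler_pdivrMr ?expR_gt0//.
  apply: (@le_trans _ _ (n.+2%:R ^+ k)).
    by rewrite -powR_mulrn ?ler0n// ler_powR// ler1n.
  have := @expR_ge1Dxn R n.+2%:R k (ler0n _ _).
  move=> h; have {}h : n.+2%:R ^+ k.+1 / k.+1`!%:R <= expR n.+2%:R :> R.
    by rewrite (le_trans _ h)// lerDr.
  rewrite -(ler_pM2l (x := k.+1`!%:R / n.+2%:R)) in h; last first.
    by rewrite divr_gt0// ltr0n fact_gt0.
  apply: le_trans h.
  rewrite exprS le_eqVlt; apply/orP; left; apply/eqP.
  have := fact_gt0 k.+1; rewrite -(ltr0n R) => kf.
  by field; rewrite !gt_eqF// -natr1; lra.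
- exact: cvg_cst.
- rewrite -[X in _ --> X](mulr0 (k.+1`!%:R)); apply: cvgMr.
  have := @cvg_harmonic R; rewrite -(cvg_shiftS (harmonic : R^nat)).
  exact.
Unshelve. all: by end_near. Qed.

(** Exhaustion of the half-line by compact intervals away from 0; the shift to [n.+2] keeps the end
    points distinct even for [n = 0]. *)
Lemma itv_inv_nat_bigcup :
  \bigcup_n `[n.+2%:R^-1, n.+2%:R]%classic = `]0, +oo[%classic :> set R.
Proof.
apply/seteqP; split => [x [n _]|x] /=; rewrite !in_itv/=.
  by move=> /andP[+ _]; rewrite andbT; apply: lt_le_trans.
rewrite andbT => x0.
pose m := maxn (Num.truncn x) (Num.truncn x^-1).
exists m => //=; rewrite in_itv/=.
apply/andP; split.
  rewrite invf_ple ?posrE//.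
  apply: (@le_trans _ _ (Num.truncn x^-1).+1%:R); first by rewrite ltW// truncnS_gt.
  by rewrite ler_nat /m -addn2 -addn1 leq_add// leq_maxr.
apply: (@le_trans _ _ (Num.truncn x).+1%:R); first by rewrite ltW// truncnS_gt.
by rewrite ler_nat /m -addn2 -addn1 leq_add// leq_maxl.
Qed.

Lemma gamma_fun_cvg a :
  (\int[mu]_(t in `[(n.+2%:R^-1)%R, n.+2%:R%R]) (gamma_fun a t)%:E)%E @[n --> \oo]
  --> eGamma a.
Proof.
rewrite /eGamma -itv_inv_nat_bigcup.
apply: ge0_nondecreasing_set_cvg_integral.
- apply/nondecreasing_seqP => n; rewrite subsetEset => x /=.
  rewrite !in_itv/= => /andP[xl xr]; apply/andP; split.
    by apply: le_trans xl; rewrite lef_pV2 ?posrE// ler_nat.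
  by rewrite (le_trans xr)// ler_nat.
- by [].
- move=> i; apply/measurable_EFinP/measurable_funTS.
  exact: measurable_gamma_fun.
- by move=> i x _; rewrite lee_fin gamma_fun_ge0.
Qed.

Lemma gamma_fun_by_parts a (u v : R) : 0 < u -> u < v ->
  (\int[mu]_(t in `[u, v]) (gamma_fun (a + 1) t)%:E
   = (u `^ a * expR (- u) - v `^ a * expR (- v))%:E
     + a%:E * \int[mu]_(t in `[u, v]) (gamma_fun a t)%:E)%E.
Proof.
move=> u0 uv.
have uvpos x : u <= x -> 0 < x by exact: lt_le_trans.
have cpow (b x : R) : u <= x -> {for x, continuous (@powR R ^~ b)}.
  move=> ux; apply: differentiable_continuous; apply/derivable1_diffP.
  by apply: derivable_powR; rewrite in_itv/= uvpos.
have cexp (x : R) : {for x, continuous (fun t : R => expR (- t))}.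
  by apply: continuous_comp; [exact: opp_continuous|exact: continuous_expR].
have dexp (x : R) : is_derive x 1 (fun t : R => - expR (- t)) (expR (- x)).
  by apply: is_derive_eq; rewrite /GRing.scale /=; ring.
have cexpN (x : R) : {for x, continuous (fun t : R => - expR (- t))}.
  by apply: continuousN; exact: cexp.
have inuv (x : R) : x \in `]u, v[ -> u <= x.
  by rewrite in_itv/= => /andP[/ltW].
have := @integration_by_parts R (@powR R ^~ a) (fun t => - expR (- t))
   (fun t => a * t `^ (a - 1)) (fun t => expR (- t)) u v uv.
have -> : (\int[mu]_(t in `[u, v]) (gamma_fun (a + 1) t)%:E =
    \int[mu]_(x in `[u, v]) (x `^ a * expR (- x))%:E)%E.
  by apply: eq_integral => x _; rewrite /gamma_fun addrK.
move=> ->.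
- have -> : (\int[mu]_(x in `[u, v]) (a * x `^ (a - 1) * - expR (- x))%:E
      = (- a)%:E * \int[mu]_(x in `[u, v]) (gamma_fun a x)%:E)%E.
    rewrite -integralZl//; last first.
      apply: continuous_compact_integrable; first exact: segment_compact.
      apply/subspace_continuousP => x /=; rewrite in_itv/= => /andP[ux _].
      by apply: cvg_within_filter; apply: cvgM; [exact: cpow|exact: cexp].
    apply: eq_integral => x _; rewrite -EFinM; congr EFin.
    by rewrite /gamma_fun; ring.
  rewrite EFinN mulNe oppeK; congr (_%:E + _)%E; ring.
- apply/subspace_continuousP => x /=; rewrite in_itv/= => /andP[ux _].
  by apply: cvg_within_filter; apply: cvgM; [exact: cvg_cst|exact: cpow].
- split=> [x /inuv ux||].
  + by apply: derivable_powR; rewrite in_itv/= uvpos.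
  + by apply: cvg_at_right_filter; exact: cpow.
  + by apply: cvg_at_left_filter; apply: cpow; exact: ltW.
- by move=> x /inuv ux; rewrite powR_derive1// in_itv/= uvpos.
- apply/subspace_continuousP => x _.
  by apply: cvg_within_filter; exact: cexp.
- split=> [x _||].
  + exact: ex_derive.
  + by apply: cvg_at_right_filter; exact: cexpN.
  + by apply: cvg_at_left_filter; exact: cexpN.
- by move=> x _; rewrite derive1E derive_val.
Qed.

(** Limit of [gamma_fun_by_parts] along the exhausting intervals. The boundary terms [r n] vanish:
    at 0 because [a > 0], at infinity because the exponential dominates. *)
Lemma eGammaS a : 0 < a -> (eGamma (a + 1) = a%:E * eGamma a)%E.
Proof.
move=> a0.
pose r n : R := n.+2%:R^-1 `^ a * expR (- n.+2%:R^-1)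
                - n.+2%:R `^ a * expR (- n.+2%:R).
have inv0 : (n.+2%:R^-1 : R) @[n --> \oo] --> (0 : R).
  have := @cvg_harmonic R; rewrite -(cvg_shiftS (harmonic : R^nat)).
  exact.
have r0 : r n @[n --> \oo] --> (0 : R).
  rewrite [X in _ --> X](_ : 0 = 0 - 0 :> R); last by rewrite subr0.
  apply: cvgB; last exact: powR_expRN_cvg0.
  rewrite [X in _ --> X](_ : 0 = 0 * expR (- 0) :> R); last by rewrite mul0r.
  apply: cvgM.
    have /cvg_at_rightP := powR_cvg0 a0; apply; split => // n.
  apply: continuous_cvg; first exact: continuous_expR.
  exact: cvgN.
apply: (cvg_unique _ (@gamma_fun_cvg (a + 1))) => //.
have -> : (fun n => \int[mu]_(t in `[(n.+2%:R^-1)%R, n.+2%:R%R]) (gamma_fun (a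
    + 1) t)%:E)%E
    = ((fun n => (r n)%:E) \+
       (fun n => a%:E * \int[mu]_(t in `[(n.+2%:R^-1)%R, n.+2%:R%R]) (gamma_fun
           a t)%:E))%E.
  apply/funext => n; rewrite gamma_fun_by_parts ?invr_gt0//.
  by rewrite (@lt_trans _ _ 1)// ?invf_lt1// ltr1n.
rewrite -[(a%:E * eGamma a)%E]add0e; apply: cvgeD => //.
  by apply: cvg_EFin => //; exact: nearW.
by apply: cvgeZl => //; exact: gamma_fun_cvg.
Qed.

Lemma eGamma_ge0 a : (0 <= eGamma a)%E.
Proof. by apply: integral_ge0 => x _; rewrite lee_fin gamma_fun_ge0. Qed.

Lemma eGamma1 : eGamma 1 = 1%E.
Proof.
rewrite /eGamma integral_itv_obnd_cbnd; last first.
  by apply/measurable_EFinP/measurable_funTS; exact: measurable_gamma_fun.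
under eq_integral do rewrite /gamma_fun subrr powRr0 mul1r.
have dexp (x : R) : is_derive x 1 (fun t : R => - expR (- t)) (expR (- x)).
  by apply: is_derive_eq; rewrite /GRing.scale /=; ring.
have cexp (x : R) : {for x, continuous (fun t : R => expR (- t))}.
  by apply: continuous_comp; [exact: opp_continuous|exact: continuous_expR].
rewrite (@ge0_continuous_FTC2y R (fun t => expR (- t)) (fun t => - expR (- t)) 0 0).
- by rewrite oppr0 expR0 sub0e -EFinN opprK.
- by move=> x _; exact: expR_ge0.
- by apply/subspace_continuousP => x _; apply: cvg_within_filter; exact: cexp.
- by rewrite -[X in _ --> X]oppr0; apply: cvgN; exact: cvgr_expR.
- by move=> x _; exact: ex_derive.
- by apply: cvg_at_right_filter; apply: cvgN; exact: cexp.
- by move=> x _; rewrite derive1E derive_val.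
Qed.

Lemma eGamma_nat n : eGamma n.+1%:R \is a fin_num.
Proof.
elim: n => [|n IHn]; first by rewrite eGamma1.
by rewrite -natr1 eGammaS ?fin_numM.
Qed.

Lemma eGamma_fin_num a : 0 < a -> eGamma a \is a fin_num.
Proof.
move=> a0.
(* Raising the argument by one removes the singularity at 0: the factor [t]^ a[is then at most]1 + t
   [^ k] for any natural [k >= a], and integer arguments are already settled. *)
suff: eGamma (a + 1) \is a fin_num.
  rewrite eGammaS// ge0_fin_numE ?mule_ge0 ?eGamma_ge0 ?lee_fin ?ltW//.
  rewrite ge0_fin_numE ?eGamma_ge0// => h.
  rewrite ltey; apply/eqP => E; move: h; rewrite E mulry gtr0_sg// mul1e.
  by rewrite ltxx.
have [k ak] : exists k : nat, a <= k%:R.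
  by exists (Num.truncn a).+1; rewrite ltW// truncnS_gt.
rewrite ge0_fin_numE ?eGamma_ge0//.
apply: (@le_lt_trans _ _ (eGamma 1 + eGamma k.+1%:R)%E); last first.
  have := eGamma_nat k; rewrite ge0_fin_numE ?eGamma_ge0// => kfin.
  by rewrite eGamma1 lte_add_pinfty// ltry.
have mg b : measurable_fun (`]0%R, +oo[%classic : set R) (fun t => (gamma_fun b
    t)%:E).
  by apply/measurable_EFinP/measurable_funTS; exact: measurable_gamma_fun.
rewrite /eGamma -ge0_integralD//; try by move=> x _; rewrite lee_fin gamma_fun_ge0.
apply: ge0_le_integral => //.
- by move=> x _; rewrite lee_fin gamma_fun_ge0.
- exact: mg.
- by apply: emeasurable_funD; exact: mg.
- move=> x; rewrite /= in_itv/= andbT => x0.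
  rewrite -EFinD lee_fin /gamma_fun subrr powRr0 -mulrDl ler_pM2r ?expR_gt0//.
  rewrite addrK -natr1 addrK.
  have [x1|x1] := leP x 1.
    apply: (@le_trans _ _ 1); last by rewrite lerDl powR_ge0.
    by rewrite -(@powRr0 _ x) ger_powR ?x0// ltW.
  by rewrite (@le_trans _ _ (x `^ k%:R))// ?lerDr// ler_powR// ltW.
- exact: mg.
- exact: mg.
Qed.

Lemma GammaE a : Gamma a = fine (eGamma a).
Proof. by []. Qed.

Lemma GammaS a : 0 < a -> Gamma (a + 1) = a * Gamma a.
Proof. by move=> a0; rewrite !GammaE eGammaS// fineM// eGamma_fin_num. Qed.

Lemma Gamma1 : Gamma 1 = 1 :> R.
Proof. by rewrite GammaE eGamma1. Qed.

Lemma Gamma_gt0 a : 0 < a -> 0 < Gamma a.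
Proof.
move=> a0; suff: 0 < Gamma (a + 1) by rewrite GammaS// pmulr_rgt0.
rewrite GammaE -lte_fin fineK ?eGamma_fin_num ?addr_gt0//.
apply: (@lt_le_trans _ _ (\int[mu]_(t in `[1%R, 2%R]) (expR (- 2))%:E)%E).
  rewrite integral_cst//= lebesgue_measure_itv/= lte_fin ltr1n/=.
  by rewrite -EFinB -EFinM lte_fin mulr_gt0 ?expR_gt0// subr_gt0 ltr1n.
apply: (@le_trans _ _ (\int[mu]_(t in `[1%R, 2%R]) (gamma_fun (a + 1) t)%:E)%E).
  apply: ge0_le_integral => //.
  - by apply/measurable_EFinP/measurable_funTS; exact: measurable_gamma_fun.
  - move=> x; rewrite /= in_itv/= => /andP[x1 x2]; rewrite lee_fin /gamma_fun.
    rewrite addrK -[leLHS]mul1r ler_pM ?expR_ge0// ?ler_expR ?lerN2//.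
    by rewrite -(@powRr0 _ x) ler_powR// ltW.
apply: ge0_subset_integral => //.
- by apply/measurable_EFinP/measurable_funTS; exact: measurable_gamma_fun.
- by move=> x _; rewrite lee_fin gamma_fun_ge0.
- move=> x /=; rewrite !in_itv/= andbT => /andP[x1 _].
  exact: lt_le_trans x1.
Qed.

(* Legendre duplication; at half-integers it follows from the functional
   equation alone, by induction on [n]. *)
Lemma Gamma_duplication_half n :
  2 ^+ n * (Gamma (n.+1%:R / 2) * Gamma (n.+2%:R / 2))
  = Gamma (1 / 2) * Gamma n.+1%:R :> R.
Proof.
elim: n => [|n IHn].
  by rewrite expr0 mul1r divff// Gamma1.
have -> : n.+3%:R / 2 = n.+1%:R / 2 + 1 :> R.
  by rewrite -[n.+3%:R]natr1 -[n.+2%:R]natr1; field.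
have -> : n.+2%:R = n.+1%:R + 1 :> R by rewrite natr1.
rewrite !GammaS ?divr_gt0//.
rewrite [RHS]mulrCA -IHn exprS natr1; by field.
Qed.

(** * Pochhammer symbols and the normalising constant of the symmetric spherical beta law *)

Lemma pochhammer0 a : 0 < a -> pochhammer a 0 = 1.
Proof. by move=> a0; rewrite /pochhammer addr0 divff// gt_eqF// Gamma_gt0. Qed.

Lemma pochhammerS a n : 0 < a -> pochhammer a n.+1 = pochhammer a n * (a + n%:R).
Proof.
move=> a0; rewrite /pochhammer -natr1 addrA GammaS ?ltr_pwDl//.
ring.
Qed.

Lemma pochhammer_gt0 a n : 0 < a -> 0 < pochhammer a n.
Proof. by move=> a0; rewrite divr_gt0// Gamma_gt0// ltr_pwDl. Qed.

(** Since [2 * l + 1 = d] is an integer, duplication at index [2 * n + d.-1] applies: its two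
    half-integer arguments are [l + 1 / 2 + n] and [l + 1 + n], and its power of 2 is the one in
    [SBeta_const]. *)
Lemma SBeta_const_diag d n : (1 <= d)%N ->
  SBeta_const d (n%:R + 1) (n%:R + 1)
  = pochhammer (lambda R d + 1) n / pochhammer (lambda R d + 1 / 2) n.
Proof.
move=> d1; rewrite /SBeta_const /pochhammer /=; set l := lambda R d.
have lE : l + 1 / 2 = d%:R / 2 by rewrite /l /lambda; field.
have l0 : 0 < l + 1 / 2 by rewrite lE divr_gt0// ltr0n.
have := Gamma_duplication_half (2 * n + d.-1).
have -> : (2 * n + d.-1).+1%:R / 2 = l + 1 / 2 + n%:R.
  by rewrite lE -addnS prednK// natrD natrM; field.
have -> : (2 * n + d.-1).+2%:R / 2 = l + 1 + n%:R.
  by rewrite -addnS prednK// -natr1 natrD natrM /l /lambda; field.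
have -> : (2 * n + d.-1).+1%:R = n%:R + 1 + (n%:R + 1) + 2 * l - 1 :> R.
  by rewrite -addnS prednK// natrD natrM /l /lambda; field.
have -> : n%:R + 1 + l - 1 / 2 = l + 1 / 2 + n%:R by field.
have -> : 2 `^ (- (n%:R + 1 + (n%:R + 1) + 2 * (l - 1))) = (2 ^+ (2 * n + d.-1))^-1.
  rewrite powRN -powR_mulrn//; congr (_ `^ _)^-1.
  rewrite natrD natrM -subn1 natrB// /l /lambda; by field.
have g1 : Gamma (l + 1 / 2) != 0 by rewrite gt_eqF// Gamma_gt0.
have g2 : Gamma (l + 1 / 2 + n%:R) != 0.
  by rewrite gt_eqF// Gamma_gt0// ltr_pwDl.
have g3 : Gamma (l + 1) != 0 by rewrite gt_eqF// Gamma_gt0//; lra.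
have p2 : 2 ^+ (2 * n + d.-1) != 0 :> R by rewrite expf_neq0.
move: g1 g2 g3 p2.
move: (Gamma (_ - 1)) (Gamma (1 / 2)) (Gamma (l + 1 + n%:R)) => x y z.
move: (Gamma (l + 1 / 2)) (Gamma (l + 1 / 2 + n%:R)) (Gamma (l + 1)) => u v w.
move: (2 ^+ _) => p u0 v0 w0 p0 E.
have -> : y * u * x = p * v * z * u by rewrite mulrAC -E; ring.
by field; rewrite u0 v0 w0 p0.
Qed.

End GammaFunction.

(** * Mixtures of the densities proportional to U^n *)

Section Mixtures.
Context {R : realType}.

Lemma expR_nneseries (y : R) : 0 <= y ->
  (\sum_(0 <= n <oo) (exp_coeff y n)%:E = (expR y)%:E)%E.
Proof.
move=> y0; rewrite /expR -EFin_lim; last exact: is_cvg_series_exp_coeff.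
by apply: congr_lim; apply/funext => n /=; rewrite sumEFin.
Qed.

(** A bound uniform in [n], which supplies the dominating function for the exponential series. *)
Lemma series_exp_coeff_le (y : R) n :
  `|series (exp_coeff y) n| <= expR `|y|.
Proof.
apply: (@le_trans _ _ (series (exp_coeff `|y|) n)).
  rewrite /series /= (le_trans (ler_norm_sum _ _ _))// ler_sum// => i _.
  by rewrite /exp_coeff /= normrM normrX normfV normr_nat.
apply: nondecreasing_cvgn_le; last exact: is_cvg_series_exp_coeff.
by apply: nondecreasing_series => i _ _; exact: exp_coeff_ge0.
Qed.

(** The general formula also covers [tau = 0]: the series then equals 1, and [0 ^+ 0 = 1] produces
    the point mass at 0. *)
Lemma chsE n (x y tau : R) : 0 < x -> 0 < y ->
  chs n x y tau = (hyp1F1 x y tau)^-1 * (pochhammer x n / pochhammer y n)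
       * (tau ^+ n / n`!%:R).
Proof.
move=> x0 y0; rewrite /chs; case: eqP => [->|//].
have -> : hyp1F1 x y 0 = 1.
  apply/cvg_lim => //; rewrite -cvg_shiftS; apply: cvg_near_cst.
  apply: nearW => n'; rewrite /series /= big_nat_recl// big1 => [|i _].
    by rewrite expr0 !pochhammer0// fact0 !(mulr1, invr1, addr0).
  by rewrite expr0n mulr0.
case: n => [|n]; first by rewrite expr0 !pochhammer0// fact0 !(mulr1,invr1).
by rewrite expr0n /= mul0r mulr0.
Qed.

(** * Probability measures given by densities *)

Section density.
Context d (T : measurableType d) (mu : {measure set T -> \bar R}) (f : T -> R).
Hypotheses (f0 : forall x, 0 <= f x) (mf : measurable_fun setT f).

Lemma density_probability : (\int[mu]_x (f x)%:E = 1)%E ->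
  exists Q : probability T R,
    forall A, measurable A -> (\int[mu]_(x in A) (f x)%:E = Q A)%E.
Proof.
move=> f1.
pose nu (A : set T) := (\int[mu]_(x in A) (f x)%:E)%E.
have nu0 : nu set0 = 0%E by rewrite /nu integral_set0.
have nu_ge0 A : (0 <= nu A)%E by apply: integral_ge0 => x _; rewrite lee_fin.
have nu_sigma : semi_sigma_additive nu.
  move=> A mA tA mUA; rewrite /nu ge0_integral_bigcup//; last 2 first.
  - exact/measurable_EFinP/measurable_funTS.
  - by move=> x _; rewrite lee_fin.
  by apply: is_cvg_ereal_nneg_natsum_cond => n _ _; exact: nu_ge0.
pose m : {measure set T -> \bar R} :=
  HB.pack nu (isMeasure.Build d T R nu nu0 nu_ge0 nu_sigma).
pose Q : probability T R :=
  HB.pack (Measure.sort m) (Measure_isProbability.Build d T R m f1).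
by exists Q.
Qed.

End density.

(** * Weights are determined by their ratio moments *)

Section uniqueness.
Variable b : R.
Hypothesis b0 : 0 < b.

(** Up to a factor depending on [k] only, this is the integral of [(1 - U) ^+ k] against the [n]-th
    density of the mixing base. *)
Definition pochhammer_ratio n k : R := pochhammer b n / pochhammer b (n + k).
Local Notation r := pochhammer_ratio.

Lemma pochhammer_ratio_gt0 n k : 0 < r n k.
Proof. by rewrite divr_gt0// pochhammer_gt0. Qed.

Lemma pochhammer_ratioS n k :
  r n.+1 k = r n k * ((b + n%:R) / (b + n%:R + k%:R)).
Proof.
rewrite /r addSn !pochhammerS// natrD.
have p1 : pochhammer b (n + k) != 0 by rewrite gt_eqF// pochhammer_gt0.
have p2 : b + n%:R + k%:R != 0.
  by rewrite gt_eqF// -addrA ltr_pwDl// addr_ge0.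
by field; rewrite p1 p2.
Qed.

Lemma pochhammer_ratio_le n m k : (n <= m)%N -> r m k <= r n k.
Proof.
move=> /subnK <-; elim: (m - n)%N => [//|j IH].
rewrite addSn pochhammer_ratioS (le_trans _ IH)//.
rewrite -[leRHS]mulr1 ler_pM2l ?pochhammer_ratio_gt0//.
by rewrite ler_pdivrMr ?mul1r ?lerDl// -addrA ltr_pwDl// addr_ge0.
Qed.

(* For [n > N] the quotient [r n k / r N k] is at most [(b + N) / (b + N + k)],
   so letting [k] tend to infinity isolates the [N]-th weight. *)
Lemma pmf_le_of_ratio_moments (w v : nat -> R) N :
  is_pmf w -> is_pmf v -> (forall n, (n < N)%N -> w n = v n) ->
  (forall k, \sum_(0 <= n <oo) (w n * r n k)%:E
             = \sum_(0 <= n <oo) (v n * r n k)%:E)%E ->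
  w N <= v N.
Proof.
move=> [w0 w1] [v0 v1] wv E.
have r0 n k := ltW (pochhammer_ratio_gt0 n k).
set B := b + N%:R.
have B0 : 0 < B by rewrite ltr_pwDl.
(* The error [B / (B + k)] is the quotient of the ratios at [N.+1] and [N]; any [k > B / e] brings
   it below [e]. *)
suff H k : w N <= v N + B / (B + k%:R).
  apply/ler_addgt0Pr => e e0.
  pose k := (Num.truncn (B / e)).+1.
  apply: (le_trans (H k)); rewrite lerD2l.
  rewrite ler_pdivrMr ?ltr_pwDl// mulrDr -[leLHS]add0r.
  rewrite lerD ?mulr_ge0 ?(ltW e0) ?(ltW B0)//.
  by rewrite mulrC -ler_pdivrMr// ltW// truncnS_gt.
have := E k.
have nneg (u : nat -> R) : (forall n, 0 <= u n) ->
    forall i, (0 <= (u i * r i k)%:E)%E.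
  by move=> u0 i; rewrite lee_fin mulr_ge0.
(* The terms below [N] agree and have a finite sum, so they cancel in the extended reals. *)
rewrite !(nneseries_split 0 N); [|by move=> i _; exact: nneg..].
rewrite !add0n [in X in (X + _ = _)%E](eq_big_nat _ _ (F2 := fun n => (v n * r
    n k)%:E));
  last by move=> i /andP[_ iN]; rewrite wv.
move=> {}E.
have {}E : (\sum_(N <= n <oo) (w n * r n k)%:E
            <= \sum_(N <= n <oo) (v n * r n k)%:E)%E.
  by move: E; rewrite sumEFin => /eqP; rewrite eq_le leeD2lE// => /andP[].
have : ((w N * r N k)%:E <= \sum_(N <= n <oo) (v n * r n k)%:E)%E.
  apply: le_trans E.
  rewrite (nneseries_split N 1); last by move=> i _; exact: nneg.
  rewrite addn1 big_nat1 leeDl// nneseries_ge0// => i _ _; exact: nneg.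
rewrite (nneseries_split N 1); last by move=> i _; exact: nneg.
rewrite addn1 big_nat1 => h.
(* The ratios decrease in [n], so each is at most the first one of the tail, and the tail weights of
   [v] sum to at most 1. *)
have tail : (\sum_(N.+1 <= n <oo) (v n * r n k)%:E <= (r N.+1 k)%:E)%E.
  apply: (@le_trans _ _ (\sum_(N.+1 <= n <oo) ((r N.+1 k)%:E * (v n)%:E))%E).
    have shift (f : nat -> \bar R) : (forall i, 0 <= f i)%E ->
        (\sum_(N.+1 <= n <oo) f n = \sum_(0 <= n <oo) f (n + N.+1)%N)%E.
      by move=> f0; rewrite -nneseries_addn.
    rewrite !shift; last 2 first.
    - by move=> i; rewrite -EFinM lee_fin mulr_ge0.
    - by move=> i; exact: nneg.
    apply: lee_nneseries => [i _ _|i _]; first exact: nneg.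
    by rewrite -EFinM lee_fin mulrC ler_wpM2r// pochhammer_ratio_le// leq_addl.
  rewrite nneseriesZl; last by move=> i _; rewrite lee_fin.
  rewrite -[leRHS]mule1 lee_pmul2l// ?lte_fin ?pochhammer_ratio_gt0//.
  rewrite -v1 (nneseries_split 0 N.+1); last by move=> i _; rewrite lee_fin.
  by rewrite leeDr// sume_ge0// => i _; rewrite lee_fin.
have := le_trans h (leeD2l _ tail).
rewrite -EFinD lee_fin pochhammer_ratioS -/B => h2.
rewrite -(ler_pM2r (pochhammer_ratio_gt0 N k)) (le_trans h2)//.
by rewrite le_eqVlt; apply/orP; left; apply/eqP; ring.
Qed.

Lemma pmf_eq_of_ratio_moments (w v : nat -> R) : is_pmf w -> is_pmf v ->
  (forall k, \sum_(0 <= n <oo) (w n * r n k)%:E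
             = \sum_(0 <= n <oo) (v n * r n k)%:E)%E ->
  w = v.
Proof.
move=> pw pv E; apply/funext; elim/ltn_ind => N IH.
by apply/eqP; rewrite eq_le !pmf_le_of_ratio_moments// => n /IH.
Qed.

End uniqueness.

(** * Power densities and exponential tilts of a variable with beta moments *)

Section PowerFamily.
Context d (T : measurableType d) (P : probability T R) (U : T -> R) (a a' : R).
Hypotheses (a0 : 0 < a) (a'0 : 0 < a') (mU : measurable_fun setT U).
Hypothesis U01 : forall x, 0 <= U x <= 1.
Hypothesis momU : forall n k,
  (\int[P]_x (U x ^+ n * (1 - U x) ^+ k)%:E
   = (pochhammer a n * pochhammer a' k / pochhammer (a + a') (n + k))%:E)%E.
Local Notation b := (a + a').

Let b0 : 0 < b. Proof. exact: addr_gt0. Qed.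
Let Uge0 x : 0 <= U x. Proof. by have /andP[] := U01 x. Qed.
Let Ule1 x : U x <= 1. Proof. by have /andP[] := U01 x. Qed.

Let mUX n : measurable_fun setT (fun x => U x ^+ n).
Proof. exact: measurable_funX. Qed.

Lemma integral_powU n :
  (\int[P]_x (U x ^+ n)%:E = (pochhammer a n / pochhammer b n)%:E)%E.
Proof.
have := momU n 0; rewrite addn0 pochhammer0// mulr1 => <-.
by under [RHS]eq_integral do rewrite expr0 mulr1.
Qed.

Lemma integrable_powU n : P.-integrable setT (EFin \o (fun x => U x ^+ n)).
Proof.
apply/integrableP; split; first exact/measurable_EFinP.
under eq_integral do rewrite gee0_abs ?lee_fin ?exprn_ge0//.
by rewrite integral_powU ltry.
Qed.

Lemma measurable_expRU tau : measurable_fun setT (fun x => expR (tau * U x)).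
Proof.
by apply: measurableT_comp => //; exact: measurable_funM.
Qed.

Lemma integral_expRU tau :
  (\int[P]_x (expR (tau * U x))%:E = (hyp1F1 a b tau)%:E)%E.
Proof.
pose f_ n x := (series (exp_coeff (tau * U x)) n)%:E.
have mf n : measurable_fun setT (fun x => series (exp_coeff (tau * U x)) n).
  rewrite /series /=; apply: measurable_sum => i.
  rewrite /exp_coeff /=; apply: measurable_funM => //.
  by apply: measurable_funX; exact: measurable_funM.
have int_coeff n : (\int[P]_x (exp_coeff (tau * U x) n)%:E
    = (pochhammer a n / (pochhammer b n * n`!%:R) * tau ^+ n)%:E)%E.
  under eq_integral => x _.
    rewrite (_ : exp_coeff _ n = tau ^+ n / n`!%:R * U x ^+ n); last first.
      by rewrite /exp_coeff /= exprMn mulrAC.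
    rewrite EFinM; over.
  rewrite integralZl//; last exact: integrable_powU.
  rewrite integral_powU -EFinM; congr EFin.
  move: (pochhammer a n) (pochhammer b n) (tau ^+ n) (n`!%:R : R) => x y z t.
  by rewrite invfM; ring.
have int_series n : (\int[P]_x f_ n x = (series (fun n =>
    pochhammer a n / (pochhammer b n * n`!%:R) * tau ^+ n) n)%:E)%E.
  rewrite /f_ /series /=.
  under eq_integral do rewrite -sumEFin.
  rewrite integral_sum//; last first.
    move=> i.
    have := integrableZl measurableT (tau ^+ i / i`!%:R) (integrable_powU i).
    apply: eq_integrable => // x _ /=.
    by rewrite -EFinM /exp_coeff /= exprMn mulrAC.
  by rewrite -sumEFin; apply: eq_bigr => i _; exact: int_coeff.
have bnd x : `|tau * U x| <= `|tau|.
  by rewrite normrM ler_piMr// ger0_norm.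
have [|||||iE _] := @dominated_convergence _ _ _ P setT measurableT f_
  (fun x => (expR (tau * U x))%:E) (fun=> (expR `|tau|)%:E) .
- by move=> n; exact/measurable_EFinP.
- exact/measurable_EFinP/measurable_expRU.
- apply: aeW => x _; apply: cvg_EFin; first exact: nearW.
  exact: is_cvg_series_exp_coeff.
- apply/integrableP; split => //.
  by rewrite integral_cst//= probability_setT mule1 ltry.
- apply: aeW => x n _; rewrite /f_ lee_fin.
  by rewrite (le_trans (series_exp_coeff_le _ _))// ler_expR.
move=> cvgI; rewrite -[LHS]fineK; last exact: integrable_fin_num.
(* [hyp1F1] is a limit of real partial sums, so the convergence of the integrals is moved from the
   extended reals to [R]. *)
congr EFin; apply/esym/cvg_lim => //.
move: cvgI; rewrite -[X in _ --> X -> _]fineK; last exact: integrable_fin_num.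
move=> /fine_cvg; apply: cvg_trans; apply: near_eq_cvg; apply: nearW => n.
by rewrite /= int_series.
Qed.

(** For [U = (eta . x)^2] and [a = 1/2] this is the density of [SP]; for [U = 1 - (eta . x)^2] and
    [a = lambda + 1/2] it is that of [SBeta] with both parameters [n + 1]. *)
Definition powU_density n x : R :=
  pochhammer b n / pochhammer a n * U x ^+ n.

Lemma powU_density_ge0 n x : 0 <= powU_density n x.
Proof.
by rewrite mulr_ge0 ?exprn_ge0// ltW// divr_gt0// pochhammer_gt0.
Qed.

Lemma measurable_powU_density n : measurable_fun setT (powU_density n).
Proof. exact: measurable_funM. Qed.

Lemma integral_powU_density n :
  (\int[P]_x (powU_density n x)%:E = 1)%E.
Proof.
under eq_integral do rewrite EFinM.
rewrite integralZl//; last exact: integrable_powU.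
rewrite integral_powU -EFinM mulf_div [X in _ / X]mulrC divff//.
by rewrite mulf_neq0// gt_eqF// pochhammer_gt0.
Qed.

Lemma hyp1F1_gt0 tau : 0 < hyp1F1 a b tau.
Proof.
have c0 : 0 < expR (- `|tau|) by exact: expR_gt0.
rewrite -lte_fin -integral_expRU (@lt_le_trans _ _ (expR (- `|tau|))%:E)//.
have {1}-> : ((expR (- `|tau|))%:E = \int[P]_x (expR (- `|tau|))%:E)%E.
  by rewrite integral_cst//= probability_setT mule1.
apply: ge0_le_integral => //.
- exact/measurable_EFinP/measurable_expRU.
- move=> x _; rewrite lee_fin ler_expR lerNl.
  by rewrite (le_trans (ler_norm _))// normrN normrM ler_piMr// ger0_norm.
Qed.

Lemma chs_ge0 tau n : 0 <= tau -> 0 <= chs n a b tau.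
Proof.
move=> t0; rewrite chsE// mulr_ge0 ?divr_ge0 ?exprn_ge0// mulr_ge0//.
  by rewrite invr_ge0 ltW// hyp1F1_gt0.
by rewrite ltW// divr_gt0// pochhammer_gt0.
Qed.

(** Each term of the exponential series is multiplied and divided by [(a)_n / (b)_n], which splits
    it into a [chs] weight and a normalised density. All terms are nonnegative for [tau >= 0], so
    sum and integral commute. *)
Lemma expRU_mixture tau A : 0 <= tau -> measurable A ->
  (\int[P]_(x in A) ((hyp1F1 a b tau)^-1 * expR (tau * U x))%:E
   = \sum_(0 <= n <oo) ((chs n a b tau)%:E *
       \int[P]_(x in A) (pochhammer b n / pochhammer a n * U x ^+ n)%:E))%E.
Proof.
move=> t0 mA.
have h0 := hyp1F1_gt0 tau.
have mUA n : measurable_fun A (fun x => U x ^+ n) by exact: measurable_funTS.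
transitivity (\int[P]_(x in A) (\sum_(0 <= n <oo)
   ((chs n a b tau)%:E *
    (pochhammer b n / pochhammer a n * U x ^+ n)%:E)))%E.
  apply: eq_integral => x _.
  rewrite EFinM -expR_nneseries; last by rewrite mulr_ge0.
  rewrite -nneseriesZl; last by move=> i _; rewrite lee_fin exp_coeff_ge0//
      mulr_ge0.
  apply: eq_eseriesr => n _; rewrite -!EFinM; congr EFin.
  rewrite chsE// /exp_coeff /= exprMn.
  have p1 : pochhammer a n != 0 by rewrite gt_eqF// pochhammer_gt0.
  have p2 : pochhammer b n != 0 by rewrite gt_eqF// pochhammer_gt0.
  move: p1 p2; move: (pochhammer a n) (pochhammer b n) (n`!%:R^-1) (hyp1F1 _ _
      _)^-1.
  by move=> p q u v p0 q0; field; rewrite p0 q0.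
rewrite integral_nneseries//.
- apply: eq_eseriesr => n _; rewrite ge0_integralZl_EFin//.
  + by move=> x _; rewrite lee_fin powU_density_ge0.
  + by apply/measurable_EFinP; apply: measurable_funM.
  + exact: chs_ge0.
- move=> n; apply/measurable_EFinP; apply: measurable_funM => //.
  by apply: measurable_funM.
- by move=> n x _; rewrite -EFinM lee_fin mulr_ge0 ?chs_ge0// powU_density_ge0.
Qed.


(** Used with [h = 1], for the mixture itself, and with [h = (1 - U) ^+ k], for its moments. *)
Lemma mixture_density_integral (w : nat -> R) (h : T -> R) A :
  (forall n, 0 <= w n) -> (forall x, 0 <= h x) -> measurable_fun setT h ->
  measurable A ->
  (\int[P]_(x in A) ((\sum_(0 <= n <oo) (w n * powU_density n x)%:E) * (h x)%:E)
   = \sum_(0 <= n <oo)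
       ((w n)%:E * \int[P]_(x in A) (powU_density n x * h x)%:E))%E.
Proof.
move=> w0 h0 mh mA.
have wf0 n x : (0 <= (w n * powU_density n x)%:E)%E.
  by rewrite lee_fin mulr_ge0// powU_density_ge0.
transitivity (\int[P]_(x in A)
    (\sum_(0 <= n <oo) (w n)%:E * (powU_density n x * h x)%:E))%E.
  apply: eq_integral => x _; rewrite muleC -nneseriesZl//.
  by apply: eq_eseriesr => n _; rewrite -!EFinM; congr EFin; ring.
rewrite integral_nneseries//.
- apply: eq_eseriesr => n _; rewrite ge0_integralZl_EFin//.
  + by move=> x _; rewrite lee_fin mulr_ge0// powU_density_ge0.
  + apply/measurable_EFinP/measurable_funTS; apply: measurable_funM => //.
    exact: measurable_powU_density.
- move=> n; apply/measurable_funTS; apply: emeasurable_funM => //.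
  apply/measurable_EFinP; apply: measurable_funM => //.
  exact: measurable_powU_density.
- by move=> n x _; rewrite -EFinM lee_fin mulr_ge0// mulr_ge0// powU_density_ge0.
Qed.

Lemma integral_powU_density_mul n k :
  (\int[P]_x (powU_density n x * (1 - U x) ^+ k)%:E
   = (pochhammer a' k * pochhammer_ratio b n k)%:E)%E.
Proof.
under eq_integral do rewrite -mulrA EFinM.
rewrite ge0_integralZl_EFin//.
- rewrite momU -EFinM; congr EFin; rewrite /pochhammer_ratio.
  have p1 : pochhammer a n != 0 by rewrite gt_eqF// pochhammer_gt0.
  have p2 : pochhammer b (n + k) != 0 by rewrite gt_eqF// pochhammer_gt0.
  move: p1 p2; move: (pochhammer a n) (pochhammer b (n + k)) => x y x0 y0.
  by field; rewrite x0 y0.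
- by move=> x _; rewrite lee_fin mulr_ge0 ?exprn_ge0// subr_ge0.
- apply/measurable_EFinP; apply: measurable_funM => //.
  by apply: measurable_funX; exact: measurable_funB.
- by rewrite ltW// divr_gt0// pochhammer_gt0.
Qed.

(* Equal mixtures have almost everywhere equal densities; integrating
   [(1 - U) ^ k] against them yields the ratio moments of the weights. *)
Lemma powU_mixture_unique (w v : nat -> R) : is_pmf w -> is_pmf v ->
  (forall A, measurable A ->
    \sum_(0 <= n <oo) ((w n)%:E * \int[P]_(x in A) (powU_density n x)%:E)
    = \sum_(0 <= n <oo) ((v n)%:E * \int[P]_(x in A) (powU_density n x)%:E))%E ->
  w = v.
Proof.
move=> pw pv E.
have m1 : measurable_fun setT (fun _ : T => 1 : R) by [].
have [w0 w1] := pw; have [v0 v1] := pv.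
pose g (u : nat -> R) x := (\sum_(0 <= n <oo) (u n * powU_density n x)%:E)%E.
have mg u : (forall n, 0 <= u n) -> measurable_fun setT (g u).
  move=> u0; apply: (@ge0_emeasurable_sum _ _ _ _ _ xpredT) => [n x _ _|n _].
    by rewrite lee_fin mulr_ge0// powU_density_ge0.
  apply/measurable_EFinP; apply: measurable_funM => //.
  exact: measurable_powU_density.
have g0 u x : (forall n, 0 <= u n) -> (0 <= g u x)%E.
  by move=> u0; apply: nneseries_ge0 => n _ _; rewrite lee_fin mulr_ge0//
      powU_density_ge0.
have intg u A : (forall n, 0 <= u n) -> measurable A ->
    (\int[P]_(x in A) g u x
     = \sum_(0 <= n <oo) ((u n)%:E * \int[P]_(x in A) (powU_density n x)%:E))%E.
  move=> u0 mA.
  have := mixture_density_integral u0 (fun=> ler01) m1 mA.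
  under eq_integral do rewrite mule1.
  move=> ->; apply: eq_eseriesr => n _; congr (_ * _)%E.
  by apply: eq_integral => x _; rewrite mulr1.
(* The mixture density [g w] is integrable, its integral being the total weight 1, so equal
   integrals over all measurable sets force equality almost everywhere. *)
have ae : ae_eq P setT (g w) (g v).
  apply: integral_ae_eq => //; [|exact: mg|].
  - apply/integrableP; split; first exact: mg.
    under eq_integral do rewrite gee0_abs ?g0//.
    rewrite intg//.
    under eq_eseriesr do rewrite integral_powU_density mule1.
    by rewrite w1 ltry.
  - by move=> A _ mA; rewrite !intg// E.
apply: (pmf_eq_of_ratio_moments b0) => // k.
pose h x := (1 - U x) ^+ k.
have h0 x : 0 <= h x by rewrite exprn_ge0// subr_ge0.
have mh : measurable_fun setT h by apply: measurable_funX; exact: measurable_funB.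
have H u : (forall n, 0 <= u n) ->
    (\int[P]_x (g u x * (h x)%:E) = (pochhammer a' k)%:E *
      \sum_(0 <= n <oo) (u n * pochhammer_ratio b n k)%:E)%E.
  move=> u0; rewrite mixture_density_integral// -nneseriesZl.
    apply: eq_eseriesr => n _.
    by rewrite integral_powU_density_mul -!EFinM mulrCA.
  by move=> n _; rewrite lee_fin mulr_ge0// ltW// pochhammer_ratio_gt0.
have : (\int[P]_x (g w x * (h x)%:E) = \int[P]_x (g v x * (h x)%:E))%E.
  apply: ge0_ae_eq_integral => //.
  - by apply: emeasurable_funM; [exact: mg|exact/measurable_EFinP].
  - by apply: emeasurable_funM; [exact: mg|exact/measurable_EFinP].
  - by move=> x _; rewrite mule_ge0 ?g0 ?lee_fin.
  - by move=> x _; rewrite mule_ge0 ?g0 ?lee_fin.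
  - by apply: filterS ae => x gE /gE ->.
(* The positive factor [(a')_k] is common to both sides; cancelling it leaves the ratio moments. *)
rewrite !H// => /(congr1 (fun x => ((pochhammer a' k)^-1)%:E * x)%E).
by rewrite !muleA -!EFinM mulVf ?mul1e// gt_eqF// pochhammer_gt0.
Qed.

End PowerFamily.
End Mixtures.

(** * Uniform distribution on the sphere *)

Section Dot.
Context {R : realType} {m : nat}.
Implicit Types u v w : 'rV[R]_m.

Lemma dot_mulmx u v : dot u v = (u *m v^T) 0 0.
Proof. by rewrite mxE; apply: eq_bigr => i _; rewrite mxE. Qed.

Lemma dotC u v : dot u v = dot v u.
Proof. by apply: eq_bigr => i _; rewrite mulrC. Qed.

Lemma dotDl u v w : dot (u + v) w = dot u w + dot v w.
Proof. by rewrite -big_split; apply: eq_bigr => i _; rewrite mxE mulrDl. Qed.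

Lemma dotZl a u w : dot (a *: u) w = a * dot u w.
Proof. by rewrite mulr_sumr; apply: eq_bigr => i _; rewrite mxE mulrA. Qed.

Lemma dotBl u v w : dot (u - v) w = dot u w - dot v w.
Proof. by rewrite -scaleN1r dotDl dotZl mulN1r. Qed.

Lemma dot_delta i u : dot (delta_mx 0 i) u = u 0 i.
Proof.
rewrite /dot (bigD1 i)//= big1 ?addr0 => [|j ji].
  by rewrite mxE !eqxx mul1r.
by rewrite mxE (negbTE ji) andbF mul0r.
Qed.

Lemma dot_ge0 u : 0 <= dot u u.
Proof. by apply: sumr_ge0 => i _; rewrite -expr2 sqr_ge0. Qed.

Lemma dot_eq0 u : (dot u u == 0) = (u == 0).
Proof.
apply/eqP/eqP => [u0|->]; last first.
  by rewrite /dot big1// => i _; rewrite mxE mul0r.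
apply/rowP => i; rewrite mxE; apply/eqP; rewrite -sqrf_eq0 expr2; apply/eqP.
by apply: (psumr_eq0P _ u0) => // j _; rewrite -expr2 sqr_ge0.
Qed.

Lemma enorm1_dot u : enorm u = 1 -> dot u u = 1.
Proof.
by move=> u1; rewrite -(sqr_sqrtr (dot_ge0 u)) -/(enorm u) u1 expr1n.
Qed.

Lemma dot_norm_le1 u v : dot u u = 1 -> dot v v = 1 -> `|dot u v| <= 1.
Proof.
move=> u1 v1; have := dot_ge0 (u + v); have := dot_ge0 (u - v).
rewrite dotBl dotDl !(dotC _ (u - v)) !(dotC _ (u + v)) !dotBl !dotDl.
by rewrite u1 v1 (dotC v u) ler_norml => h1 h2; lra.
Qed.

(** The reflection in the hyperplane orthogonal to [w = u - v] exchanges [u] and [v], which have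
    equal norms. The case [u = v] is separate because the formula divides by [c = dot w w]. *)
Lemma householder u v : dot u u = 1 -> dot v v = 1 ->
  exists2 O : 'M[R]_m, O *m O^T = 1%:M & v *m O^T = u.
Proof.
move=> u1 v1; have [<-|uv] := eqVneq u v.
  by exists 1%:M; rewrite trmx1 mulmx1.
pose w := u - v; pose c := dot w w.
have c0 : c != 0 by rewrite dot_eq0 subr_eq0.
have wwT : w *m w^T = c%:M by rewrite [LHS]mx11_scalar -dot_mulmx.
have vw : v *m w^T = (- (c / 2))%:M.
  rewrite [LHS]mx11_scalar -dot_mulmx; congr (_%:M).
  rewrite /c /w dotBl !(dotC _ (u - v)) !dotBl u1 v1 (dotC v u); by field.
have uE : u = v + w by rewrite /w addrC subrK.
clearbody c; clearbody w.
pose W := w^T *m w; pose k := 2 / c.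
have WW : W *m W = c *: W.
  by rewrite /W mulmxA -(mulmxA w^T) wwT mul_mx_scalar -scalemxAl.
have WT : W^T = W by rewrite /W trmx_mul trmxK.
have vW : v *m W = - (c / 2) *: w by rewrite /W mulmxA vw mul_scalar_mx.
clearbody W.
have OT : (1%:M - k *: W)^T = 1%:M - k *: W.
  by rewrite raddfB /= trmx1 linearZ /= WT.
exists (1%:M - k *: W); rewrite OT.
  rewrite mulmxBl mul1mx -scalemxAl mulmxBr mulmx1 -scalemxAr WW.
  rewrite !(scalerBr, scalerA) -addrA -opprD -[RHS]subr0; congr (_ - _).
  rewrite -!scalerBl -scalerDl -[RHS](scale0r W); congr (_ *: _).
  by rewrite /k; field.
rewrite mulmxBr mulmx1 -scalemxAr vW scalerA.
have -> : k * - (c / 2) = -1 by rewrite /k; field.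
by rewrite scaleN1r opprK.
Qed.

End Dot.

(** * Polynomial identities from evaluation *)

Section PolyEval.
Context {R : realType}.

(** The difference has the roots 0, 1, 2, ..., pairwise distinct in [R], as many as its size: too
    many for a nonzero polynomial. *)
Lemma poly_eq_horner (p q : {poly R}) : (forall t, p.[t] = q.[t]) -> p = q.
Proof.
move=> pq; apply/eqP; rewrite -subr_eq0; apply/eqP.
apply: (@roots_geq_poly_eq0 _ _ [seq i%:R | i <- iota 0 (size (p - q))]).
- by apply/allP => _ /mapP[i _ ->]; rewrite /root hornerD hornerN pq subrr.
- rewrite map_inj_uniq ?iota_uniq// => i j /eqP; rewrite eqr_nat => /eqP//.
- by rewrite size_map size_iota.
Qed.

Lemma coef_1DX2_exp n : ((1 + 'X^2) ^+ n.+1 : {poly R})`_2 = n.+1%:R.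
Proof.
rewrite exprDn coef_sum (bigD1 (lift ord0 ord0))//= big1 => [|i i1].
  by rewrite expr1n mul1r expr1 coefMn coefXn eqxx addr0 bin1.
rewrite expr1n mul1r -exprM coefMn coefXn.
case: eqP => [e|_]; last by rewrite mul0rn.
have /eqP i_1 : (i == 1 :> nat)%N by rewrite -(@eqn_pmul2l 2)// -e.
by move: i1; rewrite -val_eqE /= i_1.
Qed.

End PolyEval.

(** * Integrals of bounded functions and of finite sums *)

Section RintegralBounded.
Context d (T : measurableType d) {R : realType} (P : probability T R).

Lemma bounded_integrable (M : R) (f : T -> R) : measurable_fun setT f ->
  (forall x, `|f x| <= M) -> P.-integrable setT (EFin \o f).
Proof.
move=> mf fM; apply: measurable_bounded_integrable => //.
  by rewrite -ge0_fin_numE// fin_num_measure.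
exists M; split; first exact: num_real.
by move=> N MN x _; rewrite /= (le_trans (fM x))// ltW.
Qed.

Lemma Rintegral_sum n (f : 'I_n -> T -> R) :
  (forall i, P.-integrable setT (EFin \o f i)) ->
  \int[P]_x (\sum_(i < n) f i x) = \sum_(i < n) \int[P]_x f i x.
Proof.
move=> fi; rewrite /Rintegral.
under eq_integral do rewrite -sumEFin.
rewrite integral_sum//= sum_fine// => i _.
exact: (integrable_fin_num measurableT (fi i)).
Qed.

End RintegralBounded.

(** * Rotation invariance and the even moments of a coordinate *)

Section Sphere.
Context {R : realType} {d : nat}.
Local Notation S := (bsphere R d).

Lemma sphere_dot (x : sphere R d) : dot (val x) (val x) = 1.
Proof. by apply: enorm1_dot; case: x => x /= /set_mem. Qed.

Lemma measurable_coord i :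
  measurable_fun setT (fun x : S => val (x : sphere R d) 0 i).
Proof.
apply: (measurability _ (RGenOpens.measurableE R)).
move=> _ [_ [a [b ->] <-]]; rewrite setTI; apply: sub_sigma_algebra.
have /continuousP cf : continuous (fun x : sphere R d => val x 0 i).
  move=> x; apply: (@continuous_comp _ _ _ (val : sphere R d -> 'rV[R]_d.+1)
    (fun M : 'rV[R]_d.+1 => M 0 i)); last exact: coord_continuous.
  exact: initial_continuous.
exact/cf/interval_open.
Qed.

Lemma measurable_dot (u : 'rV[R]_d.+1) :
  measurable_fun setT (fun x : S => dot u (val (x : sphere R d))).
Proof.
by apply: measurable_sum => i; apply: measurable_funM => //; exact:
    measurable_coord.
Qed.

Lemma coord_norm_le1 (x : sphere R d) i : `|val x 0 i| <= 1.
Proof.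
rewrite -(@expr_le1 _ 2)// real_normK ?num_real// -[leRHS](sphere_dot x) /dot
    (bigD1 i)//= expr2 lerDl.
by apply: sumr_ge0 => j _; rewrite -expr2 sqr_ge0.
Qed.

Variables (unif : probability S R) (unifP : is_uniform unif).

(* Invariance is applied directly to the sets [{x | B (u . x)}], so that the
   measurability of isometries is never needed. *)
Lemma uniform_dot_law (u v : 'rV[R]_d.+1) (B : set R) :
  dot u u = 1 -> dot v v = 1 -> measurable B ->
  unif [set x : S | B (dot u (val (x : sphere R d)))]
  = unif [set x : S | B (dot v (val (x : sphere R d)))].
Proof.
move=> u1 v1 mB; have [Q QQ vQ] := householder u1 v1.
rewrite -[RHS](unifP QQ); last first.
  by have := measurable_dot v; move=> /(_ measurableT _ mB); rewrite setTI.
congr (unif _); apply/seteqP; split => x /=;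
  by rewrite !dot_mulmx trmx_mul mulmxA vQ.
Qed.

Lemma integral_uniform_dot (u v : 'rV[R]_d.+1) (g : R -> R) :
  dot u u = 1 -> dot v v = 1 -> measurable_fun setT g -> (forall t, 0 <= g t) ->
  (\int[unif]_x (g (dot u (val (x : sphere R d))))%:E
   = \int[unif]_x (g (dot v (val (x : sphere R d))))%:E)%E.
Proof.
move=> u1 v1 mg g0.
have push (w : 'rV[R]_d.+1) : (\int[unif]_x (g (dot w (val (x : sphere R d))))%:E
    = \int[pushforward unif (fun x : S => dot w (val (x : sphere R d)))]_t (g
        t)%:E)%E.
  rewrite ge0_integral_pushforward//.
  - exact: measurable_dot.
  - exact/measurable_EFinP.
  - by move=> t _; rewrite lee_fin.
rewrite !push; apply: eq_measure_integral; [exact: measurable_dot..|].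
by move=> mv mu B mB _; exact: uniform_dot_law.
Qed.

Definition moment n : R := \int[unif]_x (val (x : sphere R d) 0 0 ^+ (2 * n)).

Lemma integrable_coordXX i j p q : unif.-integrable setT
  (EFin \o (fun x : S => val (x : sphere R d) 0 i ^+ p * val (x : sphere R d) 0
      j ^+ q)).
Proof.
apply: (@bounded_integrable _ _ _ _ 1).
  by apply: measurable_funM; apply: measurable_funX; exact: measurable_coord.
by move=> x; rewrite normrM !normrX mulr_ile1 ?exprn_ge0 ?exprn_ile1//
    coord_norm_le1.
Qed.

Lemma moment_dot (u : 'rV[R]_d.+1) n : dot u u = 1 ->
  \int[unif]_x (dot u (val (x : sphere R d)) ^+ (2 * n)) = moment n.
Proof.
move=> u1; congr fine.
under [RHS]eq_integral do rewrite -dot_delta.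
apply: (integral_uniform_dot (g := fun t => t ^+ (2 * n))) => //.
  by rewrite dot_delta mxE !eqxx.
by move=> t; rewrite exprM exprn_ge0// sqr_ge0.
Qed.

(** The vector [e_i + t e_j] has norm [Num.sqrt (1 + t ^+ 2)]; [moment_dot] applies to its
    normalisation [v]. *)
Lemma moment_two_coords (i j : 'I_d.+1) n t : i != j ->
  \int[unif]_x ((val (x : sphere R d) 0 i + t * val (x : sphere R d) 0 j) ^+ (2
      * n))
  = moment n * (1 + t ^+ 2) ^+ n.
Proof.
move=> ij; set s := 1 + t ^+ 2.
have s0 : 0 < s by rewrite ltr_pwDl// sqr_ge0.
pose v : 'rV[R]_d.+1 := (Num.sqrt s)^-1 *: (delta_mx 0 i + t *: delta_mx 0 j).
have dv x : dot v x = (Num.sqrt s)^-1 * (x 0 i + t * x 0 j).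
  by rewrite dotZl dotDl dotZl !dot_delta.
have v1 : dot v v = 1.
  rewrite dv !mxE !eqxx (negbTE ij) eq_sym (negbTE ij) /= !mulr1 !mulr0 addr0 add0r.
  rewrite [t * _]mulrCA -mulrDr -expr2 -/s mulrA -expr2 exprVn sqr_sqrtr ?ltW//.
  by rewrite mulVf// gt_eqF.
rewrite -(moment_dot n v1) mulrC -RintegralZl//.
  apply: eq_Rintegral => x _; rewrite dv exprMn exprVn mulrA exprM.
  by rewrite exprM sqr_sqrtr ?ltW// divff ?mul1r// expf_neq0// gt_eqF.
apply: (@bounded_integrable _ _ _ _ 1).
  by apply: measurable_funX; exact: measurable_dot.
by move=> x; rewrite normrX exprn_ile1// dot_norm_le1// sphere_dot.
Qed.

(* Comparison of the coefficients of [t ^ 2] in [moment_two_coords]. *)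
Lemma moment_coordXX (i j : 'I_d.+1) n : i != j ->
  (2 * n).+1%:R * \int[unif]_x (val (x : sphere R d) 0 i ^+ (2 * n) * val (x :
      sphere R d) 0 j ^+ 2)
  = moment n.+1.
Proof.
move=> ij.
pose c k := \int[unif]_x
  (val (x : sphere R d) 0 i ^+ (2 * n.+1 - k) * val (x : sphere R d) 0 j ^+ k).
(* At each [t] both sides evaluate to the integral of [(x_i + t x_j)^(2n+2)], on the left by
   binomial expansion into the mixed moments [c k]. *)
have cE : \poly_(k < (2 * n.+1).+1) (c k *+ 'C(2 * n.+1, k))
    = moment n.+1 *: (1 + 'X^2) ^+ n.+1.
  apply: poly_eq_horner => t; rewrite horner_poly hornerZ horner_exp.
  rewrite hornerD hornerXn hornerC -(moment_two_coords n.+1 t ij).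
  under [RHS]eq_Rintegral do rewrite exprDn.
  rewrite Rintegral_sum.
    apply: eq_bigr => k _.
    rewrite -mulr_natr -mulrA mulrC -RintegralZl//; last exact: integrable_coordXX.
    by apply: eq_Rintegral => x _; rewrite exprMn -mulr_natr; ring.
  move=> k.
  have := integrableZl measurableT (t ^+ k *+ 'C(2 * n.+1, k))
      (integrable_coordXX i j (2 * n.+1 - k) k).
  apply: eq_integrable => // x _ /=.
  rewrite -EFinM; congr EFin; rewrite exprMn.
  move: (sval x 0 i ^+ _) (sval x 0 j ^+ _) (t ^+ k) => y z r.
  by rewrite mulrnAl mulrCA.
have := congr1 (fun p : {poly R} => p`_2) cE.
rewrite coefZ coef_1DX2_exp coef_poly /= ifT; last by rewrite mulnS.
have -> : c 2 = \int[unif]_x (val (x : sphere R d) 0 i ^+ (2 * n) * val (x :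
    sphere R d) 0 j ^+ 2).
  by rewrite /c mulnS addKn.
(* The factor [n.+1] cancels against the coefficient of [X^2] in [(1 + X^2)^(n+1)]. *)
have -> : 'C(2 * n.+1, 2) = (n.+1 * (2 * n).+1)%N.
  by rewrite bin2 -mulnA mul2n doubleK mulnS.
rewrite mulrnA mulrnAC -[LHS]mulr_natr [in X in _ -> X]mulr_natl.
by apply: mulIf; rewrite pnatr_eq0.
Qed.

(** Insert [1 = \sum_j x_j^2] into [moment n]: the term [j = 0] contributes [moment n.+1], and each
    of the other [d] terms contributes [moment n.+1 / (2n+1)]. *)
Lemma momentS n : (2 * n).+1%:R * moment n = ((2 * n).+1 + d)%:R * moment n.+1.
Proof.
have E : moment n = \sum_(j < d.+1)
    \int[unif]_x (val (x : sphere R d) 0 0 ^+ (2 * n) * val (x : sphere R d) 0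
        j ^+ 2).
  rewrite -Rintegral_sum; last by move=> j; exact: integrable_coordXX.
  apply: eq_Rintegral => x _; rewrite -mulr_sumr -[LHS]mulr1 -(sphere_dot x).
  by congr (_ * _); apply: eq_bigr => j _; rewrite expr2.
rewrite E big_ord_recl mulrDr.
have -> : \int[unif]_x (val (x : sphere R d) 0 0 ^+ (2 * n) * val (x : sphere R
    d) 0 ord0 ^+ 2)
    = moment n.+1.
  by apply: eq_Rintegral => x _; rewrite -exprD mulnS addnC.
rewrite mulr_sumr (eq_bigr (fun=> moment n.+1)); last first.
  by move=> j _; rewrite moment_coordXX.
by rewrite sumr_const card_ord -(mulr_natl _ d) -mulrDl -natrD.
Qed.

(** As [2 (lambda + 1) = d + 1], the factor [(2n+1) / (2n+1+d)] of [momentS] equals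
    [(1/2 + n) / (lambda + 1 + n)]. *)
Lemma momentE n : moment n = pochhammer (1 / 2) n / pochhammer (lambda R d + 1) n.
Proof.
have l0 : 0 < lambda R d + 1 by rewrite /lambda; have := ler0n R d; lra.
have h0 : 0 < 1 / 2 :> R by lra.
elim: n => [|n IH].
  rewrite !pochhammer0// divr1 /moment muln0.
  under eq_Rintegral do rewrite expr0.
  rewrite Rintegral_cst// mul1r; transitivity (fine (1 : \bar R)%E) => //.
  by congr fine; exact: probability_setT.
rewrite !pochhammerS//.
have := momentS n; rewrite IH natrD -[(2 * n).+1%:R]natr1 natrM.
have := pochhammer_gt0 n l0.
move: (pochhammer _ _) (pochhammer _ _) (moment _) => p q u q0.
have n0 : 0 <= n%:R :> R by [].
have d0 : 0 <= d%:R :> R by [].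
rewrite /lambda => E.
have D0 : (2 * n%:R + 1 + d%:R : R) != 0 by lra.
apply: (mulfI D0); rewrite -E; field.
by rewrite gt_eqF//=; lra.
Qed.

End Sphere.

(** * From power moments to mixed beta moments *)

Section BetaMoments.
Context d (T : measurableType d) {R : realType} (P : probability T R).
Context (U : T -> R) (a a' : R).
Hypotheses (a0 : 0 < a) (a'0 : 0 < a') (mU : measurable_fun setT U).
Hypothesis U01 : forall x, 0 <= U x <= 1.

(* Induction on [k] through [U^n (1-U)^(k+1) = U^n (1-U)^k - U^(n+1) (1-U)^k]. *)
Lemma beta_moments :
  (forall n, \int[P]_x (U x ^+ n)
     = pochhammer a n / pochhammer (a + a') n) ->
  forall n k,
  (\int[P]_x (U x ^+ n * (1 - U x) ^+ k)%:E
   = (pochhammer a n * pochhammer a' k / pochhammer (a + a') (n + k))%:E)%E.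
Proof.
move=> momU.
have b0 : 0 < a + a' by exact: addr_gt0.
have V01 x : 0 <= 1 - U x <= 1 by have := U01 x; lra.
have iUV n k : P.-integrable setT (EFin \o (fun x => U x ^+ n * (1 - U x) ^+ k)).
  apply: (@bounded_integrable _ _ _ _ 1).
    apply: measurable_funM; first exact: measurable_funX.
    by apply: measurable_funX; exact: measurable_funB.
  move=> x; have /andP[u0 u1] := U01 x; have /andP[v0 v1] := V01 x.
  by rewrite ger0_norm ?mulr_ge0 ?exprn_ge0// mulr_ile1 ?exprn_ge0// exprn_ile1.
suff H n k : \int[P]_x (U x ^+ n * (1 - U x) ^+ k)
    = pochhammer a n * pochhammer a' k / pochhammer (a + a') (n + k).
  move=> n k; rewrite -H /Rintegral fineK//.
  exact: (integrable_fin_num measurableT (iUV n k)).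
elim: k n => [|k IH] n.
  rewrite pochhammer0// mulr1 addn0 -momU.
  by under eq_Rintegral do rewrite expr0 mulr1.
transitivity (\int[P]_x (U x ^+ n * (1 - U x) ^+ k - U x ^+ n.+1 * (1 - U x) ^+ k)).
  by apply: eq_Rintegral => x _; rewrite !exprS; ring.
rewrite RintegralB ?IH//.
rewrite addSn addnS !pochhammerS// natrD.
have := pochhammer_gt0 (n + k) b0.
have n0 : 0 <= n%:R :> R by [].
have k0 : 0 <= k%:R :> R by [].
move: (pochhammer _ _) (pochhammer _ _) (pochhammer _ _) => p q r r0.
by field; rewrite !gt_eqF//; lra.
Qed.

End BetaMoments.

(** * Mixture representations on the sphere *)

Section Assembly.
Context {R : realType} {d : nat}.
Variables (unif : probability (bsphere R d) R) (unifP : is_uniform unif).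
Local Notation T := (sphere R d).
Local Notation l := (lambda R d).

Lemma sqr_dot01 (eta x : T) : 0 <= dot (val eta) (val x) ^+ 2 <= 1.
Proof.
rewrite sqr_ge0 -real_normK ?num_real// exprn_ile1//.
by rewrite dot_norm_le1 ?sphere_dot.
Qed.

(** These are the moments of a beta variable with parameters [1/2] and [lambda + 1/2 = d/2], the
    latter positive as [d >= 1]. *)
Lemma sqr_dot_moments (d_ge1 : (1 <= d)%N) (eta : T) n k :
  (\int[unif]_x ((dot (val eta) (val (x : T)) ^+ 2) ^+ n *
                 (1 - dot (val eta) (val (x : T)) ^+ 2) ^+ k)%:E
   = (pochhammer (1 / 2) n * pochhammer (l + 1 / 2) k
      / pochhammer (1 / 2 + (l + 1 / 2)) (n + k))%:E)%E.
Proof.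
have d1 : 1 <= d%:R :> R by rewrite ler1n.
apply: beta_moments; [lra|rewrite /lambda; lra| |exact: sqr_dot01|].
  by apply: measurable_funX; exact: measurable_dot.
move=> m; under eq_Rintegral do rewrite -exprM.
rewrite (moment_dot unifP _ (sphere_dot eta)) (momentE unifP).
by have -> : 1 / 2 + (l + 1 / 2) = l + 1 by lra.
Qed.

(** Passing from [U] to [1 - U] exchanges the two beta parameters. *)
Lemma sub_sqr_dot_moments (d_ge1 : (1 <= d)%N) (eta : T) n k :
  (\int[unif]_x ((1 - dot (val eta) (val (x : T)) ^+ 2) ^+ n *
                 (1 - (1 - dot (val eta) (val (x : T)) ^+ 2)) ^+ k)%:E
   = (pochhammer (l + 1 / 2) n * pochhammer (1 / 2) k
      / pochhammer (l + 1 / 2 + 1 / 2) (n + k))%:E)%E.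
Proof.
under eq_integral do rewrite subKr mulrC.
rewrite (sqr_dot_moments d_ge1) addnC.
by move: (lambda R d) => x; rewrite (addrC (1 / 2)) [pochhammer (1 / 2) k * _]mulrC.
Qed.

(** The common form of both parts: [P] and [Q] enter only through their densities, and [tau]
    translates the index of the family into a nonnegative tilt. *)
Lemma power_mixture_rep (I : Type) (tau : I -> R) (a a' : R)
    (P : T -> I -> set (bsphere R d) -> \bar R)
    (Q : nat -> T -> set (bsphere R d) -> \bar R)
    (U : T -> bsphere R d -> R) :
  0 < a -> 0 < a' -> (forall i, 0 <= tau i) ->
  (forall eta, measurable_fun setT (U eta)) ->
  (forall eta x, 0 <= U eta x <= 1) ->
  (forall eta n k, \int[unif]_x (U eta x ^+ n * (1 - U eta x) ^+ k)%:E
    = (pochhammer a n * pochhammer a' k / pochhammer (a + a') (n + k))%:E)%E ->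
  (forall eta i, P eta i = with_density unif (fun x =>
     (hyp1F1 a (a + a') (tau i))^-1 * expR (tau i * U eta x))) ->
  (forall n eta, Q n eta = with_density unif (fun x =>
     pochhammer (a + a') n / pochhammer a n * U eta x ^+ n)) ->
  has_unique_discrete_mixture_rep P Q
  /\ discrete_mixture_rep P Q (fun i n => chs n a (a + a') (tau i)).
Proof.
move=> a0 a'0 tau0 mU U01 momU PE QE.
have F0 eta t := hyp1F1_gt0 a'0 (mU eta) (U01 eta) (momU eta) t.
have P1 eta i : P eta i setT = 1%E.
  rewrite PE /with_density; under eq_integral do rewrite EFinM.
  rewrite ge0_integralZl_EFin//.
  - rewrite (integral_expRU a'0 (mU eta) (U01 eta) (momU eta)) -EFinM mulVf//.
    by rewrite gt_eqF// (F0 eta).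
  - exact/measurable_EFinP/measurable_expRU.
  - by rewrite invr_ge0 ltW// (F0 eta).
have Q1 n eta : Q n eta setT = 1%E.
  by rewrite QE /with_density (integral_powU_density a0 a'0 (mU eta) (U01 eta)
      (momU eta)).
have mix eta i A : measurable A ->
    (P eta i A = \sum_(0 <= n <oo) (chs n a (a + a') (tau i))%:E * Q n eta A)%E.
  move=> mA; rewrite PE /with_density (expRU_mixture a0 a'0 (mU eta) (U01 eta)
      (momU eta))//.
  by apply: eq_eseriesr => n _; rewrite QE.
have rep : discrete_mixture_rep P Q (fun i n => chs n a (a + a') (tau i)).
  split=> // [eta i|n eta|i].
  - rewrite PE; apply: density_probability.
    + by move=> x; rewrite mulr_ge0 ?expR_ge0// invr_ge0 ltW// (F0 eta).
    + by apply: measurable_funM => //; exact: measurable_expRU.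
    + by have := P1 eta i; rewrite PE.
  - rewrite QE; apply: density_probability.
    + by move=> x; exact: (powU_density_ge0 a0 a'0 (U01 eta)).
    + by apply: measurable_funM => //; exact: measurable_funX.
    + by have := Q1 n eta; rewrite QE.
  - split=> [n|]; first exact: (chs_ge0 a0 a'0 (mU point) (U01 point) (momU point)).
    (* The weights sum to 1 because the mixture identity, evaluated on the whole sphere, compares
       total masses equal to 1. *)
    rewrite -(P1 point i) mix//.
    by apply: eq_eseriesr => n _; rewrite Q1 mule1.
split=> //; exists (fun i n => chs n a (a + a') (tau i)); split=> // w [_ _ pw mw].
apply/funext => i; have [_ _ /(_ i) pchs _] := rep.
(* The weights do not depend on [eta], so a single direction, here the default [point], already
   determines them. *)
apply: (powU_mixture_unique a0 a'0 (mU point) (U01 point) (momU point)) => // A mA.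
have := mw point i A mA; rewrite mix// => E.
have H (u : nat -> R) : (\sum_(0 <= n <oo) ((u n)%:E *
      \int[unif]_(x in A) (powU_density (U point) a a' n x)%:E)
    = \sum_(0 <= n <oo) ((u n)%:E * Q n point A))%E.
  by apply: eq_eseriesr => n _; rewrite QE.
by rewrite !H.
Qed.

End Assembly.

(** * The Watson family for nonnegative and for nonpositive parameters *)

Theorem theorem3 (R : realType) (d : nat) (d_ge1 : (1 <= d)%N)
    (unif : probability (bsphere R d) R) (unifP : is_uniform unif) :
  (has_unique_discrete_mixture_rep
     (fun eta (rho : {rho : R | 0 <= rho}) => Wat unif eta (val rho))
     (fun n eta => SP unif eta n)
   /\ discrete_mixture_rep
     (fun eta (rho : {rho : R | 0 <= rho}) => Wat unif eta (val rho))
     (fun n eta => SP unif eta n)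
     (fun rho n => chs n (1 / 2) (lambda R d + 1) (val rho)))
  /\
  (has_unique_discrete_mixture_rep
     (fun eta (rho : {rho : R | rho <= 0}) => Wat unif eta (val rho))
     (fun n eta => SBeta unif eta (n%:R + 1) (n%:R + 1))
   /\ discrete_mixture_rep
     (fun eta (rho : {rho : R | rho <= 0}) => Wat unif eta (val rho))
     (fun n eta => SBeta unif eta (n%:R + 1) (n%:R + 1))
     (fun rho n => chs n (lambda R d + 1 / 2) (lambda R d + 1) (- val rho))).
Proof.
have d1 : 1 <= d%:R :> R by rewrite ler1n.
have h0 : 0 < 1 / 2 :> R by lra.
have l0 : 0 < lambda R d + 1 / 2 by rewrite /lambda; lra.
have lE1 : lambda R d + 1 = 1 / 2 + (lambda R d + 1 / 2) by lra.
have lE2 : lambda R d + 1 = lambda R d + 1 / 2 + 1 / 2 by lra.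
pose U (eta : sphere R d) (x : bsphere R d) := dot (val eta) (val (x : sphere R
    d)) ^+ 2.
have mU eta : measurable_fun setT (U eta).
  by apply: measurable_funX; exact: measurable_dot.
have U01 eta x : 0 <= U eta x <= 1 by exact: sqr_dot01.
have V01 eta x : 0 <= 1 - U eta x <= 1 by have := U01 eta x; lra.
have mV eta : measurable_fun setT (fun x => 1 - U eta x) by exact: measurable_funB.
have momU eta := sqr_dot_moments unifP d_ge1 eta.
have momV eta := sub_sqr_dot_moments unifP d_ge1 eta.
(* Kummer's transformation, read off the two expressions of [E[exp(rho U)]]. *)
have kummer rho : hyp1F1 (1 / 2) (lambda R d + 1) rho
    = expR rho * hyp1F1 (lambda R d + 1 / 2) (lambda R d + 1) (- rho).
  apply: EFin_inj; rewrite EFinM [in LHS]lE1 [in RHS]lE2.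
  rewrite -(integral_expRU l0 (mU point) (U01 point) (momU point)).
  rewrite -(integral_expRU h0 (mV point) (V01 point) (momV point)).
  rewrite -ge0_integralZl_EFin ?expR_ge0//.
  - apply: eq_integral => x _; rewrite -EFinM -expRD; congr (expR _)%:E; ring.
  - exact/measurable_EFinP/measurable_expRU.
split.
  rewrite lE1.
  apply: (@power_mixture_rep R d unif _ (fun rho : {rho : R | 0 <= rho} => val rho)
    _ _ (fun eta rho => Wat unif eta (val rho)) (fun n eta => SP unif eta n)
    U h0 l0 _ mU U01 momU).
  - by case.
  - by move=> eta rho; rewrite /Wat lE1.
  - move=> n eta; rewrite /SP lE1; congr with_density.
    by apply/funext => x; rewrite exprM.
rewrite lE2.
apply: (@power_mixture_rep R d unif _ (fun rho : {rho : R | rho <= 0} => - val rho)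
  _ _ (fun eta rho => Wat unif eta (val rho))
  (fun n eta => SBeta unif eta (n%:R + 1) (n%:R + 1))
  (fun eta x => 1 - U eta x) l0 h0 _ mV V01 momV).
- by case=> rho rho0; rewrite /= oppr_ge0.
- move=> eta rho; congr with_density; apply/funext => x.
  (* The factor [expR rho] split off by Kummer's transformation turns [rho U] into [- rho (1 - U)]
     in the exponent. *)
  rewrite kummer -lE2 invfM -expRN mulrAC -expRD mulrC; congr (_ * expR _).
  by rewrite /U; ring.
- move=> n eta; congr with_density; apply/funext => x.
  (* With [t = eta . x], both bases [1 - t] and [1 + t] are nonnegative, so the real powers are
     natural powers, and their product is [(1 - t^2)^n]. *)
  have /andP[t1 t2] : -1 <= dot (val eta) (val x) <= 1.
    by rewrite -ler_norml dot_norm_le1 ?sphere_dot.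
  rewrite SBeta_const_diag// !addrK !powR_mulrn ?subr_ge0//; last by rewrite
      -lerBlDl sub0r.
  rewrite -lE2 -mulrA -exprMn; congr (_ * _ ^+ _).
  by rewrite /U; ring.
Qed.
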